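(* Let $\mathbb{F}$ be $\mathbb{R}$ or $\mathbb{C}$, let $\langle\cdot,\cdot\rangle$ be an inner product (non-degenerate symmetric bilinear form) on $\mathbb{F}^n$, and let $\mathcal{R}$ be a Jordan-Osserman algebraic curvature tensor on $(\mathbb{F}^n,\langle\cdot,\cdot\rangle)$. Then $\mathcal{R}$ satisfies the duality principle: for any non-null $X\in\mathbb{F}^n$ and any eigenvector $Y$ of $\mathcal{R}_X$, the vector $X$ is an eigenvector of $\mathcal{R}_Y$.
   Context: $\mathbb{F}$ is $\mathbb{R}$ or $\mathbb{C}$. An inner product on $\mathbb{F}^n$ is a non-degenerate symmetric $\mathbb{F}$-bilinear form $\langle\cdot,\cdot\rangle$ (of arbitrary signature when $\mathbb{F}=\mathbb{R}$; bilinear, not Hermitian, when $\mathbb{F}=\mathbb{C}$); $\|X\|^2=\langle X,X\rangle$ is the associated quadratic form. A vector $X$ is null if $\|X\|^2=0$. An algebraic curvature tensor $\mathcal{R}$ on $(\mathbb{F}^n,\langle\cdot,\cdot\rangle)$ is a three-linear map $(X,Y,Z)\mapsto\mathcal{R}(X,Y)Z\in\mathbb{F}^n$, $X,Y,Z\in\mathbb{F}^n$, such that for all $X,Y,Z,V$: $\mathcal{R}(X,Y)Z=-\mathcal{R}(Y,X)Z$; $\mathcal{R}(X,Y)Z+\mathcal{R}(Y,Z)X+\mathcal{R}(Z,X)Y=0$; $\langle\mathcal{R}(X,Y)Z,V\rangle=\langle\mathcal{R}(Z,V)X,Y\rangle$. The Jacobi operator $\mathcal{R}_X$ is the linear operator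 on $\mathbb{F}^n$ given by $\mathcal{R}_X(Y)=\mathcal{R}(Y,X)X$. $\mathcal{R}$ is Osserman if there exists a polynomial $P\in\mathbb{F}[t,y]$ such that the characteristic polynomial $\chi_X(t)$ of $\mathcal{R}_X$ equals $P(t,\|X\|^2)$ for all $X\in\mathbb{F}^n$. $\mathcal{R}$ is Jordan-Osserman if it is Osserman and the Jordan normal form (the number and the sizes of the Jordan blocks) of $\mathcal{R}_X$ is the same for all non-null $X\in\mathbb{F}^n$; when $\mathbb{F}=\mathbb{R}$, non-real eigenvalues are allowed (the Jordan form is considered over $\mathbb{C}$). An eigenvector of $\mathcal{R}_X$ is a nonzero vector of $\mathbb{F}^n$ (with eigenvalue in $\mathbb{F}$). *)

(* Defs.v *)
From HB Require Import structures.
From mathcomp Require Import all_boot all_order all_algebra.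
From mathcomp Require Import sesquilinear reals.
From mathcomp Require Import complex.

Set Implicit Arguments.
Unset Strict Implicit.
Unset Printing Implicit Defensive.

Import GRing.Theory.
Local Open Scope ring_scope.

Section CurvatureTensors.
Variables (F : fieldType) (n : nat).
Local Notation V := 'rV[F]_n.
Implicit Types (g : {symmetric V}) (Rm : V -> V -> V -> V).

Definition sqnorm g (X : V) : F := g X X.

(* [Rm X Y Z] stands for R(X, Y)Z. *)
Record algebraic_curvature_tensor g Rm : Prop := {
  curv_linear1 : forall Y Z, linear (fun X => Rm X Y Z);
  curv_linear2 : forall X Z, linear (fun Y => Rm X Y Z);
  curv_linear3 : forall X Y, linear (fun Z => Rm X Y Z);
  curv_antisym : forall X Y Z, Rm X Y Z = - Rm Y X Z;
  curv_bianchi : forall X Y Z, Rm X Y Z + Rm Y Z X + Rm Z X Y = 0;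
  curv_pairsym : forall X Y Z W, g (Rm X Y Z) W = g (Rm Z W X) Y
}.

Definition jacobi Rm (X : V) : V -> V := fun Y => Rm Y X X.

(* Matrices act on row vectors from the right: Y *m jacobi_mx Rm X is
   jacobi Rm X Y. *)
Definition jacobi_mx Rm (X : V) : 'M[F]_n := lin1_mx (jacobi Rm X).

(* In [P] the inner variable is t and the outer one is y, so that evaluating
   the outer variable at the constant ||X||^2 gives the polynomial
   P(t, ||X||^2) in t. *)
Definition osserman g Rm : Prop :=
  exists P : {poly {poly F}},
    forall X : V, char_poly (jacobi_mx Rm X) = P.[(sqnorm g X)%:P].

Definition eigenvector (f : V -> V) (Y : V) : Prop :=
  Y != 0 /\ exists a : F, f Y = a *: Y.

Definition duality_principle g Rm : Prop :=
  forall X Y : V, sqnorm g X != 0 ->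
    eigenvector (jacobi Rm X) Y -> eigenvector (jacobi Rm Y) X.

End CurvatureTensors.

Definition jordan_block (K : fieldType) (a : K) (k : nat) : 'M[K]_k :=
  \matrix_(i, j) (a *+ (i == j) + (i.+1 == j :> nat)%:R).

(* The Jordan normal form of A has size s blocks, whose sizes are listed by s
   (up to order). The i-th block belongs to the eigenvalue a i; distinct blocks
   may share an eigenvalue. The base change P is typed as a rectangular matrix,
   since the equality of n with the sum of the block sizes is not
   definitional; being row free and row full, it is square and invertible. *)
Definition has_jordan_sizes (K : fieldType) (n : nat) (A : 'M[K]_n)
    (s : seq nat) : Prop :=
  all (leq 1) s /\
  exists (a : 'I_(size s) -> K)
         (P : 'M[K]_(\sum_(i < size s) nth 0%N s i, n)),
    [/\ row_free P, row_full P &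
        P *m A = (\mxdiag_(i < size s) jordan_block (a i) (nth 0%N s i)) *m P].

(* Jordan forms are taken over the algebraically closed field K, into which F
   embeds by iota. *)
Definition jordan_osserman (F : fieldType) (K : closedFieldType)
    (iota : {rmorphism F -> K}) (n : nat) (g : {symmetric 'rV[F]_n})
    (Rm : 'rV[F]_n -> 'rV[F]_n -> 'rV[F]_n -> 'rV[F]_n) : Prop :=
  osserman g Rm /\
  exists s : seq nat, forall X : 'rV[F]_n, sqnorm g X != 0 ->
    has_jordan_sizes (map_mx iota (jacobi_mx Rm X)) s.

(* Main.v *)
Require Import Defs.
From HB Require Import structures.
From mathcomp Require Import all_boot all_order all_algebra.
From mathcomp Require Import sesquilinear reals.
From mathcomp Require Import complex.
From mathcomp Require Import ring.

Set Implicit Arguments.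
Unset Strict Implicit.
Unset Printing Implicit Defensive.

Import GRing.Theory.
Local Open Scope ring_scope.
Local Open Scope complex_scope.

(* Let R_X Y = a Y with X non-null and let Z be orthogonal to X, with
   |Z|^2 = b |X|^2. Along X_t = (1 - b t^2) X + 2 t Z the norm is
   (1 + b t^2)^2 |X|^2, so by the Osserman condition the eigenvalues of R_{X_t}
   are those of R_X times (1 + b t^2)^2. Each rank of
   R_{X_t} - mu (1 + b t^2)^2 is at least its value at t = 0 for almost all t,
   and the sum of these ranks over all eigenvalues mu is fixed by the number of
   Jordan blocks; hence every one of them is constant for almost all t.
   A matrix family of constant rank has a derivative at t = 0 vanishing between
   the left and right kernels at t = 0. The kernel on both sides contains Y
   (R_X is self-adjoint), and the derivative paired with Y on both sides is
   4 <R_Y X, Z>. So R_Y X is orthogonal to the orthogonal complement of X,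
   hence proportional to X. *)

(** * Ranks of shifted Jordan matrices *)

Lemma mxrank_jordan_block (K : fieldType) (a mu : K) (k : nat) :
  \rank (jordan_block a k.+1 - mu%:M) = (k + (a != mu))%N.
Proof.
have [->|neq_a_mu] := eqVneq a mu; last first.
  rewrite addn1; apply/eqP; rewrite -[_ == _]/(row_free _) row_free_unit.
  rewrite unitmxE unitfE -det_tr det_trig; last first.
    apply/is_trig_mxP => i j lt_ij; rewrite !mxE -!val_eqE /=.
    by rewrite !gtn_eqF ?mulr0n ?addr0 ?subr0 // ltnW.
  apply/prodf_neq0 => i _; rewrite !mxE eqxx !mulr1n gtn_eqF //.
  by rewrite addr0 subr_eq0.
rewrite addn0; set N := _ - _.
have NE i j : N i j = (i.+1 == j :> nat)%:R.
  by rewrite !mxE addrAC subrr add0r.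
clearbody N; suff rank_ker : \rank (kermx N) = 1%N.
  by rewrite -(subKn (rank_leq_row N)) -mxrank_ker rank_ker subn1.
(* On row vectors [N] shifts each basis vector to the next one and kills the last, which therefore
   spans the kernel. *)
have -> : \rank (kermx N) = \rank (delta_mx 0 ord_max : 'rV[K]_k.+1).
  apply/eqmx_rank/andP; split; last first.
    apply/sub_kermxP; rewrite -rowE; apply/rowP => j.
    by rewrite !mxE NE gtn_eqF.
  apply/rV_subP => v /sub_kermxP vN0; apply/sub_rVP.
  exists (v 0 ord_max); apply/rowP => i; rewrite !mxE eqxx /=.
  have [->|i_neq_max] := eqVneq i ord_max; first by rewrite mulr1.
  have lt_ik : (i.+1 < k.+1)%N.
    by rewrite ltnS ltn_neqAle -ltnS ltn_ord andbT.
  have /rowP/(_ (Ordinal lt_ik)) := vN0.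
  rewrite !mxE (bigD1 i) //= NE eqxx mulr1 big1 ?addr0 ?mulr0 // => j ji.
  by rewrite NE eqSS (inj_eq val_inj) (negbTE ji) mulr0.
by rewrite mxrank_delta.
Qed.

(* The block sizes do not say which blocks share an eigenvalue, so they fix
   only the total number of blocks, not the rank at a single eigenvalue. *)
Lemma sum_rank_jordan_sizes (K : fieldType) (n : nat) (A : 'M[K]_n)
    (s : seq nat) (e : seq K) :
  has_jordan_sizes A s -> uniq e -> {subset eigenvalue A <= e} ->
  (\sum_(mu <- e) \rank (A - mu%:M)%R + size s = n * size e)%N.
Proof.
move=> [s_pos [a [P [Pfree Pfull PA]]]] e_uniq e_eig.
pose k (i : 'I_(size s)) := nth 0%N s i.
have k_gt0 i : (0 < k i)%N by apply: (allP s_pos); rewrite mem_nth.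
have sum_k : (\sum_i k i)%N = n by rewrite -(eqP Pfree) (eqP Pfull).
have rankE mu : (\rank (A - mu%:M)%R + \sum_i (a i == mu) = n)%N.
  rewrite -(eqmxMfull (A - _) Pfull) mulmxBr PA mul_mx_scalar -mul_scalar_mx.
  rewrite -mulmxBl mxrankMfree // -mxdiagZ -mxdiagB rank_mxdiag -big_split /=.
  rewrite -[RHS]sum_k; apply: eq_bigr => i _.
  move: (k_gt0 i); rewrite /k; case: (nth 0%N s i) => // k' _.
  by rewrite mxrank_jordan_block -addnA addn_negb addn1.
have a_e i : a i \in e.
  (* Were [a i] not an eigenvalue, the rank at [a i] would be [n], and [rankE] would leave no room
     for block [i]. *)
  apply: e_eig; apply: contraTT isT => /negbNE /eqP ker0.
  have := rankE (a i); rewrite -[X in _ = X]subn0 -(mxrank0 K n n) -ker0.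
  rewrite mxrank_ker subKn ?rank_leq_row // (bigD1 i) //= eqxx.
  by move/eqP; rewrite -[X in _ == X]addn0 eqn_add2l.
have -> : size s = (\sum_(mu <- e) \sum_i (a i == mu))%N.
  rewrite exchange_big /= -[LHS]card_ord -sum1_card; apply: eq_bigr => i _.
  rewrite (bigD1_seq (a i)) //= eqxx big1 // => mu.
  by rewrite eq_sym => /negbTE ->.
rewrite -big_split /= (eq_bigr (fun=> n)) => [|mu _]; last exact: rankE.
by rewrite big_const_seq count_predT iter_addn_0.
Qed.

(** * Polynomial matrices and generic rank *)

(** In characteristic zero the first [size p] naturals are too many distinct roots. Natural sample
    points are used because they come from [F] under any embedding into [K]. *)
Lemma poly_natr_nonroot (K : fieldType) (p : {poly K}) :
  [pchar K] =i pred0 -> p != 0 -> exists m : nat, p.[m%:R] != 0.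
Proof.
move=> charK p_neq0.
case: (boolP (has (fun m => p.[m%:R] != 0) (iota 0 (size p)))).
  by case/hasP => m _; exists m.
move/hasPn => roots.
have roots_p : all (root p) [seq (m%:R : K) | m <- iota 0 (size p)].
  by rewrite all_map; apply/allP => m /roots /negPn.
have natr_inj : injective (fun m : nat => m%:R : K).
  move=> m1 m2; wlog le_m12 : m1 m2 / (m1 <= m2)%N => [IH eq_m12|eq_m12].
    by case/orP: (leq_total m1 m2) => le_m; [|apply: esym]; apply: IH.
  have : (m2 - m1)%:R == 0 :> K by rewrite natrB // eq_m12 subrr.
  rewrite (pcharf0P K).1 // subn_eq0 => le_m21.
  by apply/eqP; rewrite eqn_leq le_m12.
have := max_poly_roots p_neq0 roots_p.
by rewrite map_inj_uniq ?iota_uniq // size_map size_iota ltnn => /(_ isT).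
Qed.

Lemma map_horner_polyC (K : comNzRingType) (m n : nat) (A : 'M[K]_(m, n)) x :
  map_mx (horner_eval x) (map_mx polyC A) = A.
Proof. by apply/matrixP => i j; rewrite !mxE /horner_eval hornerC. Qed.

Lemma map_hornerZ (K : comNzRingType) (m n : nat) (p : {poly K})
    (A : 'M[{poly K}]_(m, n)) x :
  map_mx (horner_eval x) (p *: A) = p.[x] *: map_mx (horner_eval x) A.
Proof. by apply/matrixP => i j; rewrite !mxE /horner_eval hornerM. Qed.

(** Compressing by these two pseudo-inverses replaces the choice of a maximal invertible minor of
    [A]. *)
Lemma mulmx_base_pinv (K : fieldType) (m n : nat) (A : 'M[K]_(m, n)) :
  pinvmx (col_base A) *m A *m pinvmx (row_base A) = 1%:M.
Proof.
have -> : pinvmx (col_base A) *m A = row_base A.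
  by rewrite -[RHS]mul1mx -(mulVpmx (col_base_full A)) -mulmxA mulmx_base.
exact/mulmxVp/row_base_free.
Qed.

(** The compression that is the identity at 0 has a polynomial determinant [q] with [q.[0] = 1].
    Where [q] does not vanish the compression stays invertible, which bounds the rank from below. *)
Lemma mxrank_horner_semicontinuous (K : fieldType) (n : nat)
    (M : 'M[{poly K}]_n) :
  exists2 q : {poly K}, q != 0 & forall x, q.[x] != 0 ->
    (\rank (map_mx (horner_eval 0) M) <= \rank (map_mx (horner_eval x) M))%N.
Proof.
set M0 := map_mx (horner_eval 0) M.
pose L := pinvmx (col_base M0); pose U := pinvmx (row_base M0).
pose N x := L *m map_mx (horner_eval x) M *m U.
pose q := \det (map_mx polyC L *m M *m map_mx polyC U).
have qE x : q.[x] = \det (N x).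
  by rewrite -/(horner_eval x q) -det_map_mx !map_mxM /= !map_horner_polyC.
exists q.
  apply: contra_eq_neq (det1 K (\rank M0)) => q0.
  by rewrite -(mulmx_base_pinv M0) -/(N 0) -qE q0 horner0 eq_sym oner_neq0.
move=> x; rewrite qE -unitfE -unitmxE -row_free_unit => /eqP <-.
by apply: leq_trans (mxrankM_maxl _ _) (mxrankM_maxr _ _).
Qed.

(* The bordered minor of M(x) = M0 + x M1 + x^2 M2(x) obtained by adding the
   row u and the column w to a maximal invertible minor of M0 vanishes as long
   as the rank does not grow; it equals (u M1 w) x + O(x^2). *)
Lemma mulmx_deriv_ker0 (K : fieldType) (n : nat) (M0 M1 : 'M[K]_n)
    (M2 : 'M[{poly K}]_n) (q : {poly K}) (u : 'rV[K]_n) (w : 'cV[K]_n) :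
  let M := map_mx polyC M0 + 'X *: map_mx polyC M1 + 'X^2 *: M2 in
  [pchar K] =i pred0 -> q != 0 ->
  (forall m : nat, q.[m%:R] != 0 ->
     (\rank (map_mx (horner_eval m%:R) M) <= \rank M0)%N) ->
  u *m M0 = 0 -> M0 *m w = 0 -> u *m M1 *m w = 0.
Proof.
move=> M charK q_neq0 rankM uM0 M0w.
pose L := pinvmx (col_base M0); pose U := pinvmx (row_base M0).
have LMU : L *m M0 *m U = 1%:M by exact: mulmx_base_pinv.
clearbody L U; pose P := col_mx L u.
pose c := map_mx polyC P *m (map_mx polyC M1 + 'X *: M2) *m map_mx polyC w.
pose N' := row_mx (map_mx polyC P *m M *m map_mx polyC U) c.
(* As [M0 *m w = 0], the last column of the bordered minor is divisible by ['X]; [N'] is the minor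
   with this factor removed. *)
have NE : map_mx polyC P *m M *m map_mx polyC (row_mx U w)
    = N' *m block_mx 1%:M 0 0 'X%:M.
  rewrite map_row_mx mul_mx_row mul_row_block mulmx1 !mulmx0 addr0 add0r.
  congr row_mx; rewrite mul_mx_scalar /M !mulmxDr !mulmxDl.
  rewrite -[_ *m map_mx polyC M0 *m _]mulmxA -map_mxM M0w map_mx0 mulmx0 add0r.
  by rewrite /c mulmxDr mulmxDl scalerDr -!scalemxAr -!scalemxAl scalerA.
(* Otherwise, at some natural number avoiding the roots of [q], the bordered minor of size
   [\rank M0 + 1] would be invertible. *)
have det_N' : \det N' = 0.
  apply: contraTeq isT => det_neq0.
  have [|m] := @poly_natr_nonroot K (q * (\det N' * 'X)) charK.
    by rewrite !mulf_neq0 ?polyX_eq0.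
  rewrite hornerM mulf_eq0 negb_or => /andP[/rankM le_rank /negP[]].
  have -> : \det N' * 'X
      = \det (map_mx polyC P *m M *m map_mx polyC (row_mx U w)).
    by rewrite NE det_mulmx det_ublock det1 mul1r det_scalar1.
  rewrite -/(horner_eval _ _) -det_map_mx; apply: contraTT le_rank.
  rewrite -unitfE -unitmxE -row_free_unit => /eqP rank_eq.
  rewrite -ltnNge -addn1 -rank_eq !map_mxM /= !map_horner_polyC.
  by apply: leq_trans (mxrankM_maxl _ _) (mxrankM_maxr _ _).
(* At 0, [u *m M0 = 0] makes [N'] block upper triangular with diagonal blocks 1 and
   [u *m M1 *m w]. *)
have := congr1 (horner_eval 0) det_N'.
rewrite -det_map_mx map_row_mx !map_mxM /= !map_mxD /= !map_hornerZ.
rewrite !map_horner_polyC !hornerE !scale0r !addr0.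
rewrite expr2 mulr0 scale0r addr0.
rewrite mul_col_mx uM0 mul_col_mx LMU mul0mx !mul_col_mx.
rewrite -block_mxEh det_ublock det1 mul1r det_mx11.
by move=> eq0; apply/matrixP => i j; rewrite !ord1 eq0 /horner_eval horner0 mxE.
Qed.

Lemma eq_sum_leq_seq (I : eqType) (r : seq I) (E1 E2 : I -> nat) :
  (forall i, i \in r -> (E1 i <= E2 i)%N) ->
  (\sum_(i <- r) E1 i = \sum_(i <- r) E2 i)%N ->
  {in r, forall i, E1 i = E2 i}.
Proof.
elim: r => // j r IHr le_E; rewrite !big_cons => eq_sum.
have le_j : (E1 j <= E2 j)%N by rewrite le_E ?mem_head.
have le_r i : i \in r -> (E1 i <= E2 i)%N.
  by move=> ir; rewrite le_E // inE ir orbT.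
have le_sum : (\sum_(i <- r) E1 i <= \sum_(i <- r) E2 i)%N.
  by rewrite !big_seq; apply: leq_sum.
have eq_j : E1 j = E2 j.
  apply/eqP; rewrite eqn_leq le_j -(leq_add2r (\sum_(i <- r) E1 i)) eq_sum.
  by rewrite leq_add2l.
move: eq_sum; rewrite eq_j => /addnI /(IHr le_r) eq_r i.
by rewrite inE => /predU1P[-> | /eq_r].
Qed.

(** * Symmetric forms and Jacobi operators *)

Lemma mul_rV_lin1_linear (F : fieldType) (m n : nat)
    (f : 'rV[F]_m -> 'rV[F]_n) u :
  linear f -> u *m lin1_mx f = f u.
Proof.
move=> f_lin; pose f' : {linear 'rV[F]_m -> 'rV[F]_n} :=
  HB.pack f (GRing.isLinear.Build _ _ _ _ f f_lin).
exact: (mul_rV_lin1 f').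
Qed.

Lemma nondegenerate_eq0 (F : fieldType) (n : nat) (g : {symmetric 'rV[F]_n}) u :
  nondegenerate g -> (forall v, g u v = 0) -> u = 0.
Proof.
move=> /eqP g_nondeg gu0; apply/eqP; rewrite -memv0 -g_nondeg.
by apply/mem_orthovP => v _.
Qed.

Section CurvatureAlgebra.
Variables (F : fieldType) (n : nat) (g : {symmetric 'rV[F]_n}).
Variable Rm : 'rV[F]_n -> 'rV[F]_n -> 'rV[F]_n -> 'rV[F]_n.
Hypothesis curv : algebraic_curvature_tensor g Rm.
Implicit Types X Y Z W : 'rV[F]_n.

Lemma symC X Y : g X Y = g Y X.
Proof. by rewrite hermC mul1r. Qed.

Lemma symNl X Y : g (- X) Y = - g X Y.
Proof. exact: linearNl. Qed.

Lemma symDl X Y Z : g (X + Y) Z = g X Z + g Y Z.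
Proof. exact: linearDl. Qed.

Lemma symZl a X Y : g (a *: X) Y = a * g X Y.
Proof. exact: linearZl_LR. Qed.

Lemma curv_skew X Y Z W : g (Rm X Y Z) W = - g (Rm X Y W) Z.
Proof.
by rewrite (curv_pairsym curv) (curv_antisym curv) symNl (curv_pairsym curv).
Qed.

Lemma jacobi_selfadjoint X Y Z : g (jacobi Rm X Y) Z = g (jacobi Rm X Z) Y.
Proof.
by rewrite (curv_pairsym curv) (curv_antisym curv) symNl [RHS]curv_skew.
Qed.

(** The polarisation of the quadratic map sending X to R_X: its derivative at X in direction Z,
    applied to Y. *)
Definition polar_jacobi X Z Y := Rm Y X Z + Rm Y Z X.

(** Here X and Y exchange roles: the curvature symmetries turn each of the two terms into the same
    pairing of R_Y X with Z. *)
Lemma polar_jacobi_form X Y Z :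
  g (polar_jacobi X Z Y) Y = g (jacobi Rm Y X) Z *+ 2.
Proof.
rewrite symDl mulr2n; congr (_ + _); last exact: (curv_pairsym curv).
by rewrite (curv_antisym curv) symNl curv_skew opprK.
Qed.

Lemma jacobi_linear X : linear (jacobi Rm X).
Proof. exact: (curv_linear1 curv). Qed.

Lemma polar_jacobi_linear X Z : linear (polar_jacobi X Z).
Proof.
move=> a U W; rewrite /polar_jacobi !(curv_linear1 curv) scalerDr.
by rewrite addrACA.
Qed.

Lemma jacobi_mx_comb a b X Z :
  jacobi_mx Rm (a *: X + b *: Z) =
  (a ^+ 2) *: jacobi_mx Rm X + (a * b) *: lin1_mx (polar_jacobi X Z)
  + (b ^+ 2) *: jacobi_mx Rm Z.
Proof.
have R2D U V V' W : Rm U (V + V') W = Rm U V W + Rm U V' W.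
  by have := curv_linear2 curv U W 1 V V'; rewrite !scale1r.
have R20 U W : Rm U 0 W = 0.
  by have /eqP := R2D U 0 0 W; rewrite addr0 -subr_eq subrr eq_sym => /eqP.
have R2Z c U V W : Rm U (c *: V) W = c *: Rm U V W.
  by have := curv_linear2 curv U W c V 0; rewrite !addr0 R20 addr0.
have R3D U V W W' : Rm U V (W + W') = Rm U V W + Rm U V W'.
  by have := curv_linear3 curv U V 1 W W'; rewrite !scale1r.
have R30 U V : Rm U V 0 = 0.
  by have /eqP := R3D U V 0 0; rewrite addr0 -subr_eq subrr eq_sym => /eqP.
have R3Z c U V W : Rm U V (c *: W) = c *: Rm U V W.
  by have := curv_linear3 curv U V c W 0; rewrite !addr0 R30 addr0.
apply/row_matrixP => i; rewrite !rowE !mulmxDr -!scalemxAr.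
rewrite !mul_rV_lin1_linear; do ?exact: jacobi_linear.
  rewrite /jacobi /polar_jacobi !(R2D, R3D, R2Z, R3Z) !scalerDr !scalerA.
  by rewrite -!expr2 [b * a]mulrC !addrA.
exact: polar_jacobi_linear.
Qed.

End CurvatureAlgebra.

(** * Eigenvalues and ranks along the pencil, and duality *)

Lemma eigenvalue_scale (K : fieldType) (n : nat) (A : 'M[K]_n) (a x : K) :
  a != 0 -> eigenvalue (a *: A) x -> eigenvalue A (x / a).
Proof.
move=> a_neq0 /eigenvalueP[v vA v_neq0]; apply/eigenvalueP; exists v => //.
by rewrite mulrC -scalerA -vA -scalemxAr scalerK.
Qed.

Lemma eigenvalue_seq (K : closedFieldType) (n : nat) (A : 'M[K]_n) :
  exists2 e : seq K, uniq e & {subset eigenvalue A <= e}.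
Proof.
have [r rE] := closed_field_poly_normal (char_poly A).
exists (undup r) => [|x]; first exact: undup_uniq.
rewrite mem_undup -topredE /= eigenvalue_root_char rE.
by rewrite (monicP (char_poly_monic A)) scale1r root_prod_XsubC.
Qed.

Section Duality.
Variables (F : numFieldType) (K : closedFieldType) (iota : {rmorphism F -> K}).
Variables (n : nat) (g : {symmetric 'rV[F]_n}).
Variable Rm : 'rV[F]_n -> 'rV[F]_n -> 'rV[F]_n -> 'rV[F]_n.
Hypothesis curv : algebraic_curvature_tensor g Rm.
Hypothesis jordan : jordan_osserman iota g Rm.

(** [X'] and [c *: X] have the same norm, so by the Osserman condition R_X' shares its
    characteristic polynomial with R_(cX) = c^2 R_X. *)
Lemma eigenvalue_jacobi_sqnorm X X' (c : F) x :
  c != 0 -> sqnorm g X' = c ^+ 2 * sqnorm g X ->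
  eigenvalue (map_mx iota (jacobi_mx Rm X')) x ->
  eigenvalue (map_mx iota (jacobi_mx Rm X)) (x / iota c ^+ 2).
Proof.
move=> c_neq0 norm_eq; rewrite eigenvalue_root_char => root_x.
apply: eigenvalue_scale; first by rewrite expf_neq0 ?fmorph_eq0.
rewrite eigenvalue_root_char -rmorphXn -map_mxZ /=.
have <- : jacobi_mx Rm (c *: X) = c ^+ 2 *: jacobi_mx Rm X.
  have := jacobi_mx_comb curv c 0 X 0.
  by rewrite scaler0 addr0 mulr0 expr0n !scale0r !addr0.
rewrite -map_char_poly; move: root_x; rewrite -map_char_poly.
have [[P PE] _] := jordan; rewrite !PE norm_eq.
suff -> : sqnorm g (c *: X) = c ^+ 2 * sqnorm g X by [].
by rewrite /sqnorm symZl symC symZl mulrA expr2.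
Qed.

(* The rational parametrisation of the conic |X_t|^2 = square: along X_t the
   norm is |X|^2 times the square of 1 + b t^2. *)
Lemma sqnorm_pencil X Z (b t : F) :
  g X Z = 0 -> sqnorm g Z = b * sqnorm g X ->
  sqnorm g ((1 - b * t ^+ 2) *: X + (2 * t) *: Z)
  = (1 + b * t ^+ 2) ^+ 2 * sqnorm g X.
Proof.
rewrite /sqnorm => XZ ZZ.
rewrite symDl !symZl ![g _ (_ + _)]symC !symDl !symZl ZZ (symC g Z X) XZ.
by ring.
Qed.

Section Pencil.
Variables (X Z : 'rV[F]_n) (b : F).
Hypotheses (X_nonnull : sqnorm g X != 0) (XZ : g X Z = 0).
Hypothesis ZZ : sqnorm g Z = b * sqnorm g X.

Let A := map_mx iota (jacobi_mx Rm X).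
Let B := map_mx iota (lin1_mx (polar_jacobi Rm X Z)).
Let C := map_mx iota (jacobi_mx Rm Z).
Let Xt (t : F) := (1 - b * t ^+ 2) *: X + (2 * t) *: Z.

(** R_(X_t) - mu (1 + b t^2)^2 expanded in t, grouped in the form M0 + t M1 + t^2 M2(t) that
    [mulmx_deriv_ker0] expects. *)
Let pencil (mu : K) : 'M[{poly K}]_n :=
  map_mx polyC (A - mu%:M) + 'X *: map_mx polyC (2 *: B) +
  'X^2 *: (((iota b ^+ 2)%:P * 'X^2 - (2 * iota b)%:P) *: map_mx polyC A
           - ((2 * iota b)%:P * 'X) *: map_mx polyC B
           + 4%:P *: map_mx polyC C
           - (mu%:P * ((2 * iota b)%:P + (iota b ^+ 2)%:P * 'X^2))%:M).

Lemma horner_pencil mu (t : F) :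
  map_mx (horner_eval (iota t)) (pencil mu)
  = map_mx iota (jacobi_mx Rm (Xt t)) - (mu * iota (1 + b * t ^+ 2) ^+ 2)%:M.
Proof.
have iota1D : iota (1 + b * t ^+ 2) = 1 + iota b * iota t ^+ 2.
  by rewrite rmorphD rmorphM rmorphXn rmorph1.
have iota1B : iota (1 - b * t ^+ 2) = 1 - iota b * iota t ^+ 2.
  by rewrite rmorphB rmorphM rmorphXn rmorph1.
have iota2 : iota (2 * t) = 2 * iota t by rewrite rmorphM rmorph_nat.
rewrite /Xt (jacobi_mx_comb curv) !map_mxD /= !map_mxZ -/A -/B -/C.
rewrite !rmorphXn [iota (_ * (2 * t))]rmorphM iota1D iota1B iota2 /pencil.
move: A B C (iota b) (iota t) => A' B' C' b' t'.
rewrite !map_mxD !map_mxN /= !map_hornerZ !map_horner_polyC.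
rewrite map_scalar_mx /= /horner_eval.
rewrite !(hornerD, hornerN, hornerM, horner_exp, hornerX, hornerC).
apply/matrixP => i j; rewrite !mxE.
by case: (i == j); rewrite ?mulr1n ?mulr0n; ring.
Qed.

Lemma pencil_at0 mu : map_mx (horner_eval 0) (pencil mu) = A - mu%:M.
Proof.
rewrite -(rmorph0 iota) horner_pencil /Xt expr0n !mulr0 subr0 addr0 rmorph1.
by rewrite expr1n mulr1 scale1r scale0r addr0.
Qed.

(* Each rank can only grow away from t = 0, while their sum over the
   eigenvalues is fixed by the number of Jordan blocks. *)
Lemma mxrank_pencil mu : eigenvalue A mu ->
  exists2 q : {poly K}, q != 0 & forall m : nat, q.[m%:R] != 0 ->
    \rank (map_mx (horner_eval m%:R) (pencil mu)) = \rank (A - mu%:M).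
Proof.
move=> A_mu; have [e e_uniq e_eig] := eigenvalue_seq A.
have [q q_neq0 le_rank] : exists2 q : {poly K}, q != 0 &
    forall x, q.[x] != 0 -> forall nu, nu \in e ->
    (\rank (A - nu%:M)%R <= \rank (map_mx (horner_eval x) (pencil nu)))%N.
  elim: {e_uniq e_eig} e => [|nu e [q q_neq0 qP]].
    by exists 1; rewrite ?oner_neq0.
  have [p p_neq0 pP] := mxrank_horner_semicontinuous (pencil nu).
  exists (p * q) => [|x]; first by rewrite mulf_neq0.
  rewrite hornerM mulf_eq0 negb_or => /andP[/pP le_nu /qP le_e] nu'.
  by rewrite inE => /predU1P[-> | /le_e //]; rewrite -pencil_at0.
(* Avoiding the roots of [d] keeps X_t non-null, so that its Jordan sizes are prescribed too. *)
pose d : {poly K} := 1%:P + (iota b)%:P * 'X^2.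
have dE t : d.[iota t] = iota (1 + b * t ^+ 2).
  rewrite !(hornerD, hornerM, horner_exp, hornerX, hornerC).
  by rewrite rmorphD rmorphM rmorphXn rmorph1.
exists (q * d) => [|m].
  rewrite mulf_neq0 //; apply: contra_eq_neq (dE 0) => ->.
  by rewrite horner0 expr0n mulr0 addr0 rmorph1 eq_sym oner_neq0.
rewrite hornerM mulf_eq0 negb_or => /andP[/le_rank le_m].
rewrite -(rmorph_nat iota) dE fmorph_eq0 => c_neq0.
set c := 1 + _ in c_neq0.
have norm_c := sqnorm_pencil m%:R XZ ZZ; rewrite -/c in norm_c.
have c2_neq0 : iota c ^+ 2 != 0 by rewrite expf_neq0 ?fmorph_eq0.
have [_ [s jordan_s]] := jordan.
have sum0 := sum_rank_jordan_sizes (jordan_s X X_nonnull) e_uniq e_eig.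
have Xm_nonnull : sqnorm g (Xt m%:R) != 0.
  by rewrite norm_c mulf_neq0 ?expf_neq0.
(* The rescaled list has the length of [e], so both sums of ranks equal [n * size e - size s]. *)
have em_eig : {subset eigenvalue (map_mx iota (jacobi_mx Rm (Xt m%:R)))
    <= [seq nu * iota c ^+ 2 | nu <- e]}.
  move=> x /(eigenvalue_jacobi_sqnorm c_neq0 norm_c) /e_eig x_e.
  by apply/mapP; exists (x / iota c ^+ 2); rewrite ?divfK.
have := sum_rank_jordan_sizes (jordan_s _ Xm_nonnull) _ em_eig.
rewrite map_inj_uniq ?size_map ?big_map; last exact: mulIf.
move=> /(_ e_uniq); rewrite -[RHS]sum0 => /addIn sum_eq.
suff rank_eq : {in e, forall nu, \rank (A - nu%:M) =
    \rank (map_mx (horner_eval (iota m%:R)) (pencil nu))}.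
  by rewrite -rank_eq ?e_eig.
apply: eq_sum_leq_seq => [nu nu_e|]; first by rewrite rmorph_nat; apply: le_m.
by rewrite -sum_eq; apply: eq_bigr => nu _; rewrite horner_pencil.
Qed.

Lemma jacobi_dual_orthogonal Y (a : F) :
  Y != 0 -> jacobi Rm X Y = a *: Y -> g (jacobi Rm Y X) Z = 0.
Proof.
move=> Y_neq0 RXY.
have mulA0 (u : 'rV_n) : u *m (jacobi_mx Rm X - a%:M) = jacobi Rm X u - a *: u.
  rewrite mulmxBr mul_mx_scalar mul_rV_lin1_linear //.
  exact: (jacobi_linear curv).
pose w : 'cV[F]_n := \col_i g (delta_mx 0 i) Y.
have mulw (u : 'rV_n) : u *m w = (g u Y)%:M.
  apply/matrixP => i j; rewrite !ord1 !mxE mulr1n symC [u in RHS]row_sum_delta.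
  rewrite linear_sumr /=; apply: eq_bigr => k _.
  by rewrite symC symZl mxE.
have Y_eig : eigenvalue A (iota a).
  rewrite eigenvalue_map; apply/eigenvalueP; exists Y => //.
  rewrite mul_rV_lin1_linear //; exact: (jacobi_linear curv).
have [q q_neq0 rank_q] := mxrank_pencil Y_eig.
have charK : [pchar K] =i pred0.
  by move=> p; rewrite (fmorph_pchar iota) Num.Theory.pchar_num.
have AE : A - (iota a)%:M = map_mx iota (jacobi_mx Rm X - a%:M).
  by rewrite map_mxB map_scalar_mx.
have := @mulmx_deriv_ker0 K n (A - (iota a)%:M) (2 *: B) _ q
  (map_mx iota Y) (map_mx iota w) charK q_neq0.
move=> /(_ _ (fun m qm => eq_leq (rank_q m qm))).
rewrite AE -!map_mxM /= mulA0 RXY subrr map_mx0 => /(_ erefl).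
(* [w] represents pairing with Y, so self-adjointness turns the left eigenvector Y into the right
   kernel vector [w]. *)
have -> : (jacobi_mx Rm X - a%:M) *m w = 0.
  apply/row_matrixP => i; rewrite rowE mulmxA mulA0 mulmxBl row0.
  rewrite -scalemxAl !mulw (jacobi_selfadjoint curv) RXY.
  by rewrite symZl symC scale_scalar_mx subrr.
rewrite map_mx0 => /(_ erefl).
rewrite -scalemxAr -scalemxAl -!map_mxM mul_rV_lin1_linear; last first.
  exact: (polar_jacobi_linear curv).
(* One factor 2 comes from the velocity 2Z of X_t at t = 0, the other from polarisation; both cancel
   in characteristic zero. *)
rewrite mulw (polar_jacobi_form curv) map_scalar_mx scale_scalar_mx.
move=> /matrixP/(_ 0 0); rewrite !mxE mulr1n => /eqP.
rewrite mulf_eq0 fmorph_eq0 Num.Theory.mulrn_eq0 /= ((pcharf0P K).1 charK) /=.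
by move/eqP.
Qed.

End Pencil.

Lemma jordan_osserman_duality : nondegenerate g -> duality_principle g Rm.
Proof.
move=> g_nondeg X Y X_nonnull [Y_neq0 [a RXY]].
have X_neq0 : X != 0.
  by apply: contraNneq X_nonnull => ->; rewrite /sqnorm linear0l.
(* Pairing R_Y X = l X with X forces this value of [l]. *)
split=> //; pose l := g (jacobi Rm Y X) X / sqnorm g X; exists l.
apply/eqP; rewrite -subr_eq0; apply/eqP/(nondegenerate_eq0 g_nondeg) => W.
rewrite symDl symNl symZl.
(* The test vector [W] is split into a multiple of X and a part [Z] orthogonal to X. *)
pose k := g W X / sqnorm g X.
pose Z := W - k *: X.
have XZ : g X Z = 0.
  by rewrite symC symDl symNl symZl divfK ?subrr.
have -> : W = Z + k *: X by rewrite subrK.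
have ZZ : sqnorm g Z = sqnorm g Z / sqnorm g X * sqnorm g X by rewrite divfK.
clearbody Z; rewrite ![g _ (Z + _)]symC !symDl !symZl (symC g Z X) XZ add0r.
rewrite (symC g Z) (jacobi_dual_orthogonal X_nonnull XZ ZZ Y_neq0 RXY) add0r.
by rewrite (symC g X) mulrCA divfK // subrr.
Qed.

End Duality.

Theorem theorem1 (R : realType) (n : nat) :
  (forall (g : {symmetric 'rV[R]_n})
          (Rm : 'rV[R]_n -> 'rV[R]_n -> 'rV[R]_n -> 'rV[R]_n),
     nondegenerate g -> algebraic_curvature_tensor g Rm ->
     jordan_osserman (real_complex R : {rmorphism R -> R[i]}) g Rm ->
     duality_principle g Rm)
  /\
  (forall (g : {symmetric 'rV[R[i]]_n})
          (Rm : 'rV[R[i]]_n -> 'rV[R[i]]_n -> 'rV[R[i]]_n -> 'rV[R[i]]_n),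
     nondegenerate g -> algebraic_curvature_tensor g Rm ->
     jordan_osserman (idfun : {rmorphism R[i] -> R[i]}) g Rm ->
     duality_principle g Rm).
Proof.
split=> g Rm g_nondeg curv jordan.
  exact: (jordan_osserman_duality curv jordan g_nondeg).
exact: (jordan_osserman_duality curv jordan g_nondeg).
Qed.
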